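(* Let $J_3$ be the Flower snark on the $12$ vertices $x_0,x_1,x_{-1},y_0,y_1,y_{-1},z_0,z_1,z_{-1},v_0,v_1,v_{-1}$ whose $18$ edges are: $z_0v_0$, $z_0x_0$, $z_0y_0$, $v_0v_1$, $v_0v_{-1}$, $v_1v_{-1}$, $x_0x_1$, $x_0x_{-1}$, $y_0y_1$, $y_0y_{-1}$, $v_1z_1$, $v_{-1}z_{-1}$, $x_1z_1$, $y_1z_1$, $x_{-1}z_{-1}$, $y_{-1}z_{-1}$, $x_{-1}y_1$, $x_1y_{-1}$. Then $J_3$ is Class~$0$, i.e., its pebbling number is $\pi(J_3)=n(J_3)=12$.
   Context: A configuration $C$ on a graph $G$ assigns to each vertex $v$ a nonnegative integer $C(v)$ (number of pebbles). A pebbling move removes two pebbles from a vertex $v$ and places one pebble on a vertex adjacent to $v$. A configuration is $r$-solvable if some sequence of pebbling moves results in at least one pebble on the target vertex $r$. The pebbling number $\pi(G)$ is the minimum integer $t$ such that for every vertex $r$ of $G$, every configuration with $t$ pebbles in total is $r$-solvable. One always has $\pi(G)\ge n(G)$, the number of vertices, and $G$ is called Class~$0$ if $\pi(G)=n(G)$. The graph $J_3$ (also called Tietze's graph) is the Petersen graph with one vertex replaced by a triangle. *)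

(* Defs.v *)
(* Graph pebbling on a finite simple graph given by a
   symmetric irreflexive adjacency relation on a finType. *)
From Stdlib Require Import Relations.
From mathcomp Require Import all_boot.
Set Implicit Arguments. Unset Strict Implicit. Unset Printing Implicit Defensive.

Section Pebbling.
Variables (T : finType) (adj : rel T).

Definition config := {ffun T -> nat}.

Definition config_size (C : config) : nat := \sum_(v : T) C v.

Definition pebbling_move (C C' : config) : Prop :=
  exists u w, [/\ adj u w, 2 <= C u &
    C' = [ffun x => (if x == u then C x - 2 else C x) + (if x == w then 1 else 0)]].

Definition reachable : relation config := clos_refl_trans config pebbling_move.

Definition solvable (r : T) (C : config) : Prop :=
  exists C', reachable C C' /\ 0 < C' r.

Definition all_solvable (t : nat) : Prop :=
  forall (r : T) (C : config), config_size C = t -> solvable r C.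

Definition is_pebbling_number (t : nat) : Prop :=
  all_solvable t /\ forall t', t' < t -> ~ all_solvable t'.

Definition class0 : Prop := is_pebbling_number #|T|.
End Pebbling.

(* Vertex labelling of J_3 on 'I_12:
   x0=0, x1=1, x_{-1}=2, y0=3, y1=4, y_{-1}=5,
   z0=6, z1=7, z_{-1}=8, v0=9, v1=10, v_{-1}=11. *)
Definition J3_edges : seq (nat * nat) :=
  [:: (6,9); (6,0); (6,3); (9,10); (9,11); (10,11);
      (0,1); (0,2); (3,4); (3,5); (10,7); (11,8);
      (1,7); (4,7); (2,8); (5,8); (2,4); (1,5)].

Definition J3_adj : rel 'I_12 :=
  fun u w => ((nat_of_ord u, nat_of_ord w) \in J3_edges)
          || ((nat_of_ord w, nat_of_ord u) \in J3_edges).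

(* Main.v *)
(** Fix a root [r].  If every vertex of positive weight [g] has a neighbour that is [r] or has
    at least twice its weight, then pebbling towards these neighbours never decreases
    [sum g C], so [sum g < sum g C] forces a solution.  An unsolvable configuration [C] thus
    satisfies many linear inequalities, one for each such [g] and each configuration reachable
    from [C].  These inequalities alone do not bound the size of [C] by [11], but they do after
    finitely many case distinctions [k <= C v] / [C v < k]: lower bounds on [C] make more
    moves available.  The resulting branch-and-bound trees, found by linear programming, are
    checked by computation, with one tree for each of the three vertex orbits. *)
From Stdlib Require Import Relations.
Require Import Defs.
From mathcomp Require Import all_boot zify.
Set Implicit Arguments. Unset Strict Implicit. Unset Printing Implicit Defensive.

(** * Weight functions and the two general bounds on solvability *)

Section Weights.
Variables (T : finType) (adj : rel T).
Implicit Types (C : config T) (u v w r : T).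

Definition pebble C u w : config T :=
  [ffun x => (if x == u then C x - 2 else C x) + (if x == w then 1 else 0)].

Lemma reachable_pebble C u w :
  adj u w -> 2 <= C u -> reachable adj C (pebble C u w).
Proof. by move=> auw Cu; apply: rt_step; exists u, w. Qed.

Lemma solvable_reachable r C C' :
  reachable adj C C' -> solvable adj r C' -> solvable adj r C.
Proof. by move=> CC' [C'' [C'C'' C''r]]; exists C''; split=> //; apply: rt_trans C'C''. Qed.

(** A move trades weight [2 * g u] for weight [g w]. The balance is stated additively because
    subtraction on [nat] truncates. *)
Lemma weight_pebble (g : T -> nat) C u w : 2 <= C u ->
  \sum_x g x * pebble C u w x + 2 * g u = \sum_x g x * C x + g w.
Proof.
move=> Cu.
(* The two isolated terms become sums over one-point predicates, so that the identity can be proved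
   vertex by vertex. *)
rewrite -[in 2 * _](big_pred1_eq addn u g) -(big_pred1_eq addn w g) big_distrr /=.
rewrite !(big_mkcond (pred1 _)) -!big_split; apply: eq_bigr => x _ /=.
rewrite ffunE; case: (x =P u) => [->|_]; case: (_ == w); nia.
Qed.

(** The strict inequality forces a vertex [v] of positive weight with at least two pebbles. A move
    from [v] to its neighbour [p] either reaches [r] or keeps the inequality true. Each move loses
    one pebble, so the second case cannot go on forever; hence the induction on a bound [m] for the
    size. *)
Lemma weight_solvable r (g : T -> nat) C :
    (forall v, 0 < g v -> exists2 p, adj v p & p = r \/ 2 * g v <= g p) ->
  \sum_x g x < \sum_x g x * C x -> solvable adj r C.
Proof.
move=> gP; move: {2}(config_size C) (leqnn (config_size C)) => m.
elim: m C => [|m IHm] C Cm gC.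
  have C0 x : C x = 0.
    by apply/eqP; rewrite -leqn0; apply: leq_trans Cm; rewrite /config_size (bigD1 x) //= leq_addr.
  by move: gC; rewrite [X in _ < X]big1 // => x _; rewrite C0 muln0.
(* Otherwise [C x <= 1] wherever [g x] is positive, and the weighted sum is at most [\sum_x g x]. *)
have /existsP[v /andP[gv Cv]] : [exists v, (0 < g v) && (2 <= C v)].
  apply: contraLR gC; rewrite negb_exists -leqNgt => /forallP hC.
  by apply: leq_sum => x _; have := hC x; case: (g x) => // k; rewrite /= -ltnNge; nia.
have [p avp pP] := gP _ gv; have CC' := reachable_pebble avp Cv.
apply: solvable_reachable (CC') _.
case: pP => [<-|gp].
  by exists (pebble C v p); split; [apply: rt_refl | rewrite ffunE eqxx addn1].
apply: IHm.
  (* With the constant weight 1, the balance of the move says that the size drops by one. *)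
  have := weight_pebble (fun=> 1) p Cv.
  rewrite !(eq_bigr _ (fun x _ => mul1n _)) => /eqP; move: Cm; rewrite /config_size; lia.
by have := weight_pebble g p Cv; lia.
Qed.

(** One pebble on each of [t] vertices allows no move at all, so a root among the remaining vertices
    is never reached. *)
Lemma not_all_solvable_lt_card t : t < #|T| -> ~ all_solvable adj t.
Proof.
(* In the enumeration of [T], the vertices of index below [t] receive a pebble, and the root is the
   first empty one, of index [t]. *)
move=> tT solv; pose r := enum_val (Ordinal tT).
pose C : config T := [ffun x => enum_rank x < t : nat].
have Csize : config_size C = t.
  rewrite /config_size (reindex (enum_val : 'I_#|T| -> T)) /=; last first.
    by apply: onW_bij; apply: enum_val_bij.
  rewrite (eq_bigr (fun i : 'I_#|T| => if i < t then 1 else 0)); last first.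
    by move=> i _; rewrite ffunE enum_valK; case: ifP.
  by rewrite -big_mkcond -(big_ord_widen _ (fun=> 1) (ltnW tT)) sum1_card card_ord.
have [C' [CC' C'r]] := solv r C Csize.
suff CE : C' = C by move: C'r; rewrite CE ffunE enum_valK ltnn.
(* A nontrivial sequence would begin with a move from a vertex carrying two pebbles. *)
case: (clos_rt_rt1n _ _ _ _ CC') => // D E [u [w [_ Cu _]]] _.
by move: Cu; rewrite ffunE; case: (_ < t).
Qed.

End Weights.

(** * Certificates and their checker, on plain natural numbers so that they compute *)

Definition vec := nat -> nat.

Definition upd (l : vec) (v k : nat) : vec := fun x => if x == v then k else l x.

(** The counterpart of [pebble] for vectors. It is played on a lower bound of the configuration, the
    only information available to the checker. *)
Definition shift (l : vec) (m : nat * nat) : vec :=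
  fun x => (if x == m.1 then l x - 2 else l x) + (if x == m.2 then 1 else 0).

(* A multiplier, a sequence of moves and a weight function: the weight inequality for the
   configuration obtained by these moves, to be scaled by the multiplier. *)
Definition cut : eqType := (nat * seq (nat * nat) * seq nat)%type.

Definition mult (c : cut) : nat := c.1.1.

Definition moves (c : cut) : seq (nat * nat) := c.1.2.

Definition wt (c : cut) : vec := nth 0 c.2.

(* [Split v k hi lo] distinguishes [k <= C v] (certificate [hi]) from [C v < k]
   (certificate [lo]).  In [Leaf mu cs], [mu] is the multiplier of [sum C = t] in a linear
   combination with the weight inequalities [cs] that contradicts the bounds on [C]. *)
Inductive cert :=
  | Split of nat & nat & cert & cert
  | Leaf of nat & seq cut.

Section Certificates.
Variables (n : nat) (e : rel nat) (t r : nat).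
Implicit Types (l u f g : vec) (c : cut) (cs : seq cut).

Let adj : rel 'I_n := fun v w => e v w.

(** A list sum instead of a big operator, since the latter is locked and would block evaluation. *)
Definition total f : nat := sumn [seq f i | i <- iota 0 n].

Definition dot f g : nat := total (fun i => f i * g i).

(** Moves that can be played from [l] can be played from every configuration above [l]. *)
Fixpoint legal l (ms : seq (nat * nat)) : bool :=
  if ms is m :: ms' then
    [&& m.1 < n, m.2 < n, e m.1 m.2, 2 <= l m.1 & legal (shift l m) ms']
  else true.

(** The boolean form of the condition on [g] in [weight_solvable]. *)
Definition valid_weight f : bool :=
  all (fun v => (f v == 0) ||
    has (fun p => e v p && ((p == r) || (2 * f v <= f p))) (iota 0 n)) (iota 0 n).

Definition combine (F : cut -> nat) cs : nat := sumn [seq mult c * F c | c <- cs].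

(* A linear combination [sum a C <= b] of cuts and [sum C = t] are contradictory if [b] is less
   than [t * mu + sum (a - mu) C], where a positive coefficient [a - mu] is estimated with the
   lower bound [l] and a negative one with the upper bound [u]. *)
Definition refutes l u mu cs : bool :=
  let a i := combine (wt^~ i) cs in
  dot (fun i => mu - a i) u + combine (fun c => total (wt c) + dot (wt c) l) cs
  < t * mu + dot (fun i => a i - mu) l
    + combine (fun c => dot (wt c) (foldl shift l (moves c))) cs.

(** The invariant is [l <= C <= u] at every vertex. A split overwrites the old bound at [v], which
    is sound because the case hypothesis alone justifies the new one; [C v < k] gives the upper
    bound [k.-1]. *)
Fixpoint check l u (ct : cert) : bool :=
  match ct with
  | Split v k hi lo => [&& v < n, check (upd l v k) u hi & check l (upd u v k.-1) lo]
  | Leaf mu cs =>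
      all (fun c => legal l (moves c) && valid_weight (wt c)) cs && refutes l u mu cs
  end.

(** * Soundness of the checker *)

Lemma totalE f : total f = \sum_(i < n) f i.
Proof. by rewrite /total sumnE big_map -{1}[n]subn0 big_mkord. Qed.

(** The same moves change [C] and [l] by the same amounts: [l] stays below the configuration, so no
    subtraction truncates. The conclusion says [C' - l = C - l] for the initial and final vectors,
    without subtraction. *)
Lemma reachable_shift l ms (C : config 'I_n) :
    legal l ms -> (forall i : 'I_n, l i <= C i) ->
  exists2 C', reachable adj C C' & forall i : 'I_n, C' i + l i = C i + foldl shift l ms i.
Proof.
elim: ms l C => [|[a b] ms IHms] l C /=; first by exists C => //; apply: rt_refl.
case/and5P=> an bn eab la /IHms{}IHms lC.
have Ca := leq_trans la (lC (Ordinal an)).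
have CC1 := @reachable_pebble _ adj C (Ordinal an) (Ordinal bn) eab Ca.
have pE (i : 'I_n) : pebble C (Ordinal an) (Ordinal bn) i + l i = C i + shift l (a, b) i.
  rewrite ffunE /shift -!val_eqE /=; move: (lC i).
  by case: (val i =P a) => [->|_] ?; case: (_ == b); lia.
have [i|C' C1C' C'E] := IHms (pebble C (Ordinal an) (Ordinal bn)).
  by rewrite -(leq_add2r (l i)) pE addnC leq_add2r.
exists C'; first exact: rt_trans C1C'.
(* Adding the intermediate bound to both sides lets the identities for the first move and for the
   rest be chained. *)
move=> i; apply/eqP; rewrite -(eqn_add2r (shift l (a, b) i)).
by rewrite addnAC C'E addnAC pE addnAC.
Qed.

(** The inequality is [weight_solvable] for the configuration [C'] reached by the moves of the cut,
    rewritten in terms of [C], since [C'] differs from [C] by a known vector. *)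
Lemma cut_solvable (ro : 'I_n) l c (C : config 'I_n) :
    val ro = r -> legal l (moves c) -> valid_weight (wt c) ->
    (forall i : 'I_n, l i <= C i) ->
    total (wt c) + dot (wt c) l
      < \sum_(i < n) wt c i * C i + dot (wt c) (foldl shift l (moves c)) ->
  solvable adj ro C.
Proof.
move=> rE lc /allP wv lC; have [C' CC' C'E] := reachable_shift lc lC.
rewrite /dot !totalE => ineq; apply: solvable_reachable CC' _.
apply: (@weight_solvable _ _ _ (fun i : 'I_n => wt c i)).
  move=> v wv0; have := wv v; rewrite mem_iota ltn_ord => /(_ isT).
  rewrite (gtn_eqF wv0) /= => /hasP[p]; rewrite mem_iota /= => pn /andP[evp pP].
  exists (Ordinal pn) => //; case/orP: pP => [/eqP pr|]; last by right.
  by left; apply: val_inj; rewrite rE.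
have wE : \sum_(i < n) wt c i * C' i + \sum_(i < n) wt c i * l i
   = \sum_(i < n) wt c i * C i + \sum_(i < n) wt c i * foldl shift l (moves c) i.
  by rewrite -!big_split; apply: eq_bigr => i _ /=; rewrite -!mulnDr C'E.
by rewrite -(ltn_add2r (\sum_(i < n) wt c i * l i)) wE.
Qed.

Lemma leq_combine F G cs :
  all (fun c => F c <= G c) cs -> combine F cs <= combine G cs.
Proof.
rewrite /combine; elim: cs => //= c cs IHcs /andP[FG /IHcs]; exact/leq_add/leq_mul.
Qed.

Lemma combineD F G cs :
  combine (fun c => F c + G c) cs = combine F cs + combine G cs.
Proof. by rewrite /combine; elim: cs => //= c cs ->; rewrite mulnDr addnACA. Qed.

(** Exchanging the sums exhibits the coefficient of each [C i] in the combined inequality, called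
    [a i] in [refutes]. *)
Lemma combine_sum (C : config 'I_n) cs :
  combine (fun c => \sum_(i < n) wt c i * C i) cs
  = \sum_(i < n) combine (wt^~ i) cs * C i.
Proof.
rewrite /combine; elim: cs => [|c cs IHcs] /=; first by rewrite big1.
rewrite IHcs big_distrr -big_split; apply: eq_bigr => i _ /=.
by rewrite mulnDl mulnA.
Qed.

(** Induction on the tree. At a leaf, either some cut inequality fails, and that cut solves [C], or
    all hold, and their combination contradicts the bounds and the size. *)
Lemma check_solvable (ro : 'I_n) l u ct (C : config 'I_n) :
    val ro = r -> config_size C = t -> (forall i : 'I_n, l i <= C i <= u i) ->
  check l u ct -> solvable adj ro C.
Proof.
move=> rE Ct; elim: ct l u => [v k hi IHhi lo IHlo|mu cs] l u luC /=.
  case/and3P=> vn hic loc; case: (leqP k (C (Ordinal vn))) => kC.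
    apply: IHhi hic => i; rewrite /upd; case: eqP => // iv.
    have -> : i = Ordinal vn by apply: val_inj.
    by rewrite kC; have /andP[] := luC (Ordinal vn).
  apply: IHlo loc => i; rewrite /upd; case: eqP => // iv.
  have -> : i = Ordinal vn by apply: val_inj.
  by have /andP[-> _] := luC (Ordinal vn); rewrite -ltnS (ltn_predK kC).
case/andP=> /allP csP ref.
have lC (i : 'I_n) : l i <= C i by have /andP[] := luC i.
case: (boolP (all (fun c => \sum_(i < n) wt c i * C i
    + dot (wt c) (foldl shift l (moves c)) <= total (wt c) + dot (wt c) l) cs)).
  move/leq_combine; rewrite combineD combine_sum => le_cs; exfalso.
  pose a i := combine (wt^~ i) cs.
  (* Since [t * mu] is the sum of the [mu * C i], this can be proved termwise. Truncated subtraction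
     yields positive parts: at each [i], one of [a i - mu] and [mu - a i] vanishes, and the other is
     estimated with [l i <= C i] or [C i <= u i]. *)
  have low : t * mu + dot (fun i => a i - mu) l
     <= dot (fun i => mu - a i) u + \sum_(i < n) a i * C i.
    rewrite /dot !totalE -Ct /config_size big_distrl -!big_split.
    apply: leq_sum => i _ /=; have /andP[lCi Ciu] := luC i.
    have [ma|/ltnW am] := leqP mu (a i).
      rewrite (eqP (ma : mu - a i == 0)) add0n -[in leqRHS](subnKC ma) mulnDl.
      by rewrite [mu * _]mulnC leq_add2l leq_mul2l lCi orbT.
    rewrite (eqP (am : a i - mu == 0)) addn0 -[in leqLHS](subnK am) mulnDr.
    by rewrite ![C i * _]mulnC leq_add2r leq_mul2l Ciu orbT.
  (* The sums are abstracted into variables, which leaves a purely linear contradiction. *)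
  have absurd P Q A X Y : P + Y < Q + X -> Q <= P + A -> A + X <= Y -> False by lia.
  exact: absurd ref low le_cs.
rewrite -has_predC => /hasP[c ccs]; rewrite /= -ltnNge => ineq.
by have /andP[lc wc] := csP c ccs; apply: cut_solvable lc wc lC ineq.
Qed.

End Certificates.

(** * Certificates for the three orbits of roots of [J_3] *)

(** Transport along the permutation [i -> nth 0 s i]. Weights are read at the preimage [index i s].
    The relabelled trees are themselves submitted to [check]. *)
Fixpoint relabel (s : seq nat) (ct : cert) : cert :=
  match ct with
  | Split v k hi lo => Split (nth 0 s v) k (relabel s hi) (relabel s lo)
  | Leaf mu cs => Leaf mu
      [seq (mult c, [seq (nth 0 s m.1, nth 0 s m.2) | m <- moves c],
            [seq wt c (index i s) | i <- iota 0 (size s)]) | c <- cs]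
  end.

(** Root [x_0], whose orbit consists of the six vertices [x_i] and [y_i]. The weights at least
    double along a path towards a neighbour of the root, as in a tree hanging from the root. *)
Definition cert_x0 : cert :=
 (Split 5 1
  (Split 3 1
   (Split 10 1
    (Split 11 1
     (Split 4 1
      (Split 8 1
       (Split 7 1
        (Split 11 4
         (* Leaves with multiplier 0 are explicit solutions: the moves put two pebbles on a
            neighbour of the root, which is given weight 1, so that the weight inequality fails
            outright. *)
         (Leaf 0
          [:: (1, [:: (11,8); (11,10); (10,7); (8,5); (7,1); (5,1)],
               [:: 0; 1; 0; 0; 0; 0; 0; 0; 0; 0; 0; 0])])
         (Split 10 4
          (Leaf 0
           [:: (1, [:: (10,7); (10,11); (11,8); (8,5); (7,1); (5,1)],
                [:: 0; 1; 0; 0; 0; 0; 0; 0; 0; 0; 0; 0])])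
          (Split 1 1
           (Leaf 11
            [:: (1, [::], [:: 0; 2; 16; 0; 8; 0; 0; 4; 8; 2; 1; 4]);
             (3, [::], [:: 0; 0; 0; 2; 1; 1; 4; 0; 0; 2; 1; 1]);
             (2, [::], [:: 0; 8; 0; 2; 0; 4; 0; 4; 2; 0; 0; 1]);
             (2, [::], [:: 0; 8; 0; 2; 0; 4; 0; 4; 2; 1; 2; 1]);
             (2, [::], [:: 0; 16; 0; 0; 4; 0; 0; 8; 1; 2; 4; 2])])
           (Split 2 1
            (Leaf 2
             [:: (1, [::], [:: 0; 2; 16; 0; 8; 0; 0; 4; 8; 2; 1; 4]);
              (1, [::], [:: 0; 0; 0; 0; 0; 0; 2; 0; 0; 1; 0; 0]);
              (1, [::], [:: 0; 0; 8; 2; 4; 0; 0; 2; 4; 0; 1; 0]);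
              (1, [::], [:: 0; 0; 8; 2; 4; 2; 0; 2; 4; 0; 1; 2])])
            (Split 9 1
             (Split 10 2
              (Leaf 22
               [:: (1, [::], [:: 0; 0; 8; 2; 4; 0; 0; 2; 4; 0; 1; 0]);
                (2, [::], [:: 0; 16; 0; 0; 4; 0; 0; 8; 1; 2; 4; 2]);
                (5, [::], [:: 0; 0; 0; 4; 2; 0; 8; 1; 1; 4; 2; 2]);
                (* The earlier splits guarantee two pebbles on vertex 10 and one on each of 7 and 4,
                   so a pebble can be carried along this path. *)
                (3, [:: (10,7); (7,4); (4,2)], [:: 0; 0; 4; 0; 0; 0; 0; 0; 2; 0; 0; 1]);
                (6, [:: (10,7); (7,1)], [:: 0; 8; 0; 0; 0; 4; 0; 0; 2; 0; 0; 1])])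
              (Split 9 2
               (Leaf 18
                [:: (2, [::], [:: 0; 8; 0; 2; 0; 4; 0; 4; 2; 1; 2; 1]);
                 (1, [::], [:: 0; 0; 0; 4; 0; 2; 8; 1; 1; 4; 2; 2]);
                 (3, [::], [:: 0; 0; 0; 4; 2; 0; 8; 1; 1; 4; 2; 2]);
                 (2, [::], [:: 0; 0; 8; 0; 4; 2; 0; 2; 4; 1; 0; 2]);
                 (2, [::], [:: 0; 0; 0; 4; 2; 2; 8; 1; 1; 4; 0; 2])])
               (Leaf 80
                [:: (7, [::], [:: 0; 8; 0; 2; 0; 4; 0; 4; 2; 1; 2; 1]);
                 (4, [::], [:: 0; 8; 0; 0; 2; 4; 0; 4; 2; 0; 2; 1]);
                 (5, [::], [:: 0; 0; 0; 4; 2; 0; 8; 1; 1; 4; 2; 2]);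
                 (13, [::], [:: 0; 0; 8; 2; 4; 2; 0; 2; 4; 1; 0; 2]);
                 (5, [::], [:: 0; 0; 0; 4; 2; 2; 8; 1; 1; 4; 0; 2])])))
             (Split 6 1
              (Leaf 7
               [:: (1, [::], [:: 0; 0; 8; 2; 4; 2; 0; 2; 4; 0; 1; 2]);
                (1, [::], [:: 0; 0; 0; 4; 2; 0; 8; 1; 1; 4; 2; 2]);
                (1, [::], [:: 0; 8; 0; 2; 0; 4; 0; 4; 2; 0; 2; 1]);
                (1, [::], [:: 0; 0; 0; 4; 2; 2; 8; 1; 1; 4; 2; 2])])
              (Split 3 2
               (Leaf 5
                [:: (1, [::], [:: 0; 0; 0; 2; 1; 1; 4; 0; 0; 2; 1; 1]);
                 (1, [::], [:: 0; 0; 8; 2; 4; 2; 0; 2; 4; 0; 1; 2]);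
                 (1, [::], [:: 0; 8; 0; 2; 2; 4; 0; 4; 0; 0; 2; 1]);
                 (1, [:: (3,5); (5,1)], [:: 0; 8; 0; 0; 0; 0; 0; 4; 0; 0; 2; 1]);
                 (1, [:: (3,4); (4,2)], [:: 0; 0; 8; 0; 0; 0; 0; 0; 4; 0; 1; 2])])
               (Leaf 5
                [:: (1, [::], [:: 0; 0; 8; 2; 4; 2; 0; 2; 4; 0; 1; 2]);
                 (1, [::], [:: 0; 8; 0; 0; 2; 4; 0; 4; 2; 0; 2; 1])]))))))))
        (Split 1 1
         (Leaf 13
          [:: (5, [::], [:: 0; 0; 0; 2; 1; 1; 4; 0; 0; 2; 1; 1]);
           (1, [::], [:: 0; 8; 0; 2; 0; 4; 0; 4; 2; 1; 2; 1]);
           (1, [::], [:: 0; 16; 0; 0; 4; 0; 0; 8; 1; 2; 4; 2]);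
           (2, [::], [:: 0; 0; 8; 2; 4; 0; 0; 0; 4; 0; 1; 2]);
           (2, [::], [:: 0; 8; 0; 0; 0; 4; 0; 0; 2; 0; 0; 1])])
         (Split 10 6
          (Leaf 0
           [:: (1, [:: (10,7); (10,7); (10,11); (11,8); (8,5); (7,1); (5,1)],
                [:: 0; 1; 0; 0; 0; 0; 0; 0; 0; 0; 0; 0])])
          (Split 11 2
           (Leaf 4
            [:: (1, [::], [:: 0; 0; 8; 0; 0; 2; 0; 0; 4; 0; 1; 2]);
             (1, [::], [:: 0; 0; 0; 4; 0; 2; 8; 0; 1; 4; 2; 2]);
             (1, [:: (11,8); (8,2)], [:: 0; 0; 8; 0; 4; 0; 0; 2; 0; 0; 1; 0])])
           (Leaf 30
            [:: (5, [::], [:: 0; 0; 0; 2; 1; 1; 4; 0; 0; 2; 1; 1]);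
             (1, [::], [:: 0; 8; 0; 0; 2; 4; 0; 4; 2; 0; 2; 1]);
             (5, [::], [:: 0; 0; 0; 4; 0; 2; 8; 0; 1; 4; 2; 2]);
             (6, [::], [:: 0; 0; 8; 0; 4; 2; 0; 0; 4; 0; 1; 2])])))))
       (Split 7 1
        (Split 11 6
         (Leaf 0
          [:: (1, [:: (11,8); (11,8); (11,10); (10,7); (8,5); (7,1); (5,1)],
               [:: 0; 1; 0; 0; 0; 0; 0; 0; 0; 0; 0; 0])])
         (Split 2 1
          (Leaf 10
           [:: (1, [::], [:: 0; 2; 16; 0; 8; 0; 0; 4; 8; 2; 1; 4]);
            (4, [::], [:: 0; 0; 0; 2; 1; 1; 4; 0; 0; 2; 1; 1]);
            (1, [::], [:: 0; 0; 8; 2; 4; 2; 0; 2; 4; 0; 1; 2]);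
            (1, [::], [:: 0; 8; 0; 0; 0; 4; 0; 4; 0; 0; 2; 1]);
            (2, [::], [:: 0; 0; 8; 0; 4; 0; 0; 2; 0; 0; 1; 0])])
          (Split 4 2
           (Leaf 12
            [:: (2, [::], [:: 0; 0; 8; 2; 4; 2; 0; 2; 4; 0; 1; 2]);
             (1, [::], [:: 0; 8; 0; 0; 2; 0; 0; 4; 0; 0; 2; 1]);
             (3, [::], [:: 0; 0; 0; 4; 2; 2; 8; 1; 0; 4; 2; 2]);
             (1, [::], [:: 0; 8; 0; 0; 2; 4; 0; 4; 0; 0; 2; 1])])
           (Split 10 2
            (Leaf 4
             [:: (1, [::], [:: 0; 8; 0; 0; 0; 0; 0; 4; 0; 0; 2; 1]);
              (1, [::], [:: 0; 0; 0; 4; 2; 2; 8; 1; 0; 4; 2; 2]);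
              (1, [:: (10,7); (7,1)], [:: 0; 8; 0; 0; 0; 4; 0; 0; 2; 0; 0; 1])])
            (Leaf 15
             [:: (2, [::], [:: 0; 8; 0; 0; 0; 4; 0; 4; 0; 0; 2; 1]);
              (1, [::], [:: 0; 8; 0; 0; 2; 0; 0; 4; 0; 0; 2; 1]);
              (4, [::], [:: 0; 0; 0; 4; 2; 2; 8; 1; 0; 4; 2; 2])])))))
        (Leaf 7
         [:: (4, [::], [:: 0; 0; 0; 2; 1; 1; 4; 0; 0; 2; 1; 1]);
          (1, [::], [:: 0; 0; 8; 0; 4; 0; 0; 0; 4; 0; 1; 2]);
          (1, [::], [:: 0; 8; 0; 0; 0; 4; 0; 4; 0; 0; 2; 1])])))
      (Leaf 24
       [:: (1, [::], [:: 0; 0; 0; 0; 0; 0; 4; 0; 0; 2; 1; 1]);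
        (2, [::], [:: 0; 0; 0; 2; 1; 1; 4; 0; 0; 2; 1; 1]);
        (3, [::], [:: 0; 0; 8; 0; 0; 0; 0; 0; 4; 0; 1; 2]);
        (2, [::], [:: 0; 8; 0; 2; 0; 4; 0; 4; 2; 1; 2; 1]);
        (4, [::], [:: 0; 0; 0; 4; 0; 0; 8; 1; 1; 4; 2; 2]);
        (3, [::], [:: 0; 8; 0; 0; 0; 4; 0; 4; 0; 0; 2; 1]);
        (2, [::], [:: 0; 0; 4; 0; 0; 1; 0; 0; 2; 0; 0; 1])]))
     (Leaf 24
      [:: (1, [::], [:: 0; 4; 0; 0; 0; 2; 0; 2; 0; 0; 1; 0]);
       (4, [::], [:: 0; 0; 0; 2; 1; 1; 4; 0; 0; 2; 1; 1]);
       (3, [::], [:: 0; 0; 8; 2; 4; 0; 0; 2; 4; 0; 1; 0]);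
       (4, [::], [:: 0; 8; 0; 0; 2; 4; 0; 4; 2; 0; 2; 1]);
       (4, [::], [:: 0; 0; 0; 4; 0; 2; 8; 0; 1; 4; 2; 0])]))
    (Leaf 16
     [:: (1, [::], [:: 0; 0; 8; 0; 0; 0; 0; 0; 4; 0; 1; 2]);
      (2, [::], [:: 0; 8; 0; 2; 0; 4; 0; 4; 2; 0; 0; 1]);
      (2, [::], [:: 0; 0; 8; 2; 4; 2; 0; 2; 4; 0; 1; 2]);
      (4, [::], [:: 0; 0; 0; 4; 2; 2; 8; 1; 0; 4; 0; 2])]))
   (Leaf 14
    [:: (7, [::], [:: 0; 0; 0; 0; 0; 0; 4; 0; 0; 2; 1; 1]);
     (1, [::], [:: 0; 0; 8; 0; 4; 0; 0; 0; 4; 0; 1; 2]);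
     (3, [::], [:: 0; 8; 0; 0; 2; 4; 0; 4; 2; 0; 2; 1]);
     (2, [::], [:: 0; 0; 4; 0; 2; 1; 0; 1; 2; 0; 0; 1])]))
  (Leaf 28
   [:: (1, [::], [:: 0; 0; 0; 2; 1; 1; 4; 0; 0; 2; 1; 1]);
    (1, [::], [:: 0; 8; 0; 0; 0; 0; 0; 4; 0; 0; 2; 1]);
    (1, [::], [:: 0; 0; 8; 2; 4; 2; 0; 2; 4; 0; 1; 2]);
    (4, [::], [:: 0; 0; 8; 0; 4; 0; 0; 0; 4; 0; 1; 2]);
    (6, [::], [:: 0; 0; 0; 4; 0; 0; 8; 1; 1; 4; 2; 2]);
    (2, [::], [:: 0; 16; 0; 0; 4; 0; 0; 8; 1; 2; 4; 2])])).

(** Root [z_0], vertex 6; its orbit is formed by the three [z_i], the neighbours of the triangle. *)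
Definition cert_z0 : cert :=
 (Split 7 1
  (Split 11 1
   (Split 2 1
    (Split 1 1
     (Split 8 1
      (Split 10 1
       (Split 8 4
        (Leaf 0
         [:: (1, [:: (8,2); (8,11); (11,10); (10,7); (7,1); (2,0); (1,0)],
              [:: 1; 0; 0; 0; 0; 0; 0; 0; 0; 0; 0; 0])])
        (Split 4 1
         (Split 7 4
          (Leaf 0
           [:: (1, [:: (7,4); (7,1); (4,2); (2,0); (1,0)],
                [:: 1; 0; 0; 0; 0; 0; 0; 0; 0; 0; 0; 0])])
          (Split 5 1
           (Split 8 2
            (Leaf 21
             [:: (3, [::], [:: 8; 4; 4; 0; 2; 2; 0; 2; 2; 0; 0; 1]);
              (2, [::], [:: 0; 1; 2; 0; 0; 2; 0; 0; 4; 16; 8; 8]);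
              (3, [::], [:: 0; 2; 2; 8; 4; 4; 0; 2; 2; 0; 1; 1]);
              (2, [:: (8,5); (5,3)], [:: 0; 0; 0; 4; 2; 0; 0; 1; 0; 0; 0; 0]);
              (6, [:: (8,2); (2,0)], [:: 4; 2; 0; 0; 0; 0; 0; 1; 0; 0; 0; 0]);
              (1, [:: (8,11); (11,9)], [:: 0; 0; 0; 0; 0; 0; 0; 1; 0; 4; 2; 0])])
            (Leaf 31
             [:: (2, [::], [:: 8; 4; 4; 0; 2; 2; 0; 2; 2; 0; 0; 1]);
              (3, [::], [:: 0; 1; 1; 0; 1; 0; 0; 2; 2; 8; 4; 4]);
              (3, [::], [:: 0; 1; 1; 0; 0; 1; 0; 2; 2; 8; 4; 4]);
              (5, [::], [:: 0; 2; 2; 8; 4; 4; 0; 2; 2; 0; 1; 1]);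
              (2, [::], [:: 8; 4; 4; 0; 2; 2; 0; 2; 2; 0; 1; 0])]))
           (Leaf 8
            [:: (2, [::], [:: 0; 1; 1; 0; 1; 0; 0; 2; 2; 8; 4; 4]);
             (1, [::], [:: 0; 2; 2; 8; 4; 4; 0; 2; 2; 0; 1; 1]);
             (1, [::], [:: 8; 4; 4; 0; 2; 2; 0; 2; 2; 0; 1; 0])])))
         (Leaf 8
          [:: (2, [::], [:: 0; 1; 1; 0; 0; 1; 0; 2; 2; 8; 4; 4]);
           (1, [::], [:: 0; 2; 2; 8; 4; 4; 0; 2; 2; 0; 1; 1]);
           (1, [::], [:: 8; 4; 4; 0; 2; 2; 0; 2; 2; 0; 1; 0])])))
       (Leaf 24
        [:: (5, [::], [:: 8; 4; 4; 0; 2; 2; 0; 2; 2; 0; 0; 1]);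
         (2, [::], [:: 0; 1; 1; 0; 1; 0; 0; 2; 2; 8; 4; 4]);
         (2, [::], [:: 0; 1; 1; 0; 0; 1; 0; 2; 2; 8; 4; 4]);
         (3, [::], [:: 0; 2; 2; 8; 4; 4; 0; 2; 2; 0; 1; 1])]))
      (Leaf 41
       [:: (1, [::], [:: 0; 4; 0; 16; 8; 8; 0; 4; 0; 0; 2; 1]);
        (4, [::], [:: 8; 4; 4; 0; 2; 2; 0; 2; 2; 0; 0; 1]);
        (4, [::], [:: 0; 1; 1; 0; 1; 0; 0; 2; 2; 8; 4; 4]);
        (4, [::], [:: 0; 1; 1; 0; 0; 1; 0; 2; 2; 8; 4; 4]);
        (3, [::], [:: 8; 4; 4; 0; 2; 2; 0; 2; 0; 0; 1; 0]);
        (4, [::], [:: 0; 2; 2; 8; 4; 4; 0; 2; 2; 0; 1; 1])]))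
     (Leaf 24
      [:: (2, [::], [:: 0; 0; 0; 0; 0; 0; 0; 1; 1; 4; 2; 2]);
       (3, [::], [:: 0; 0; 2; 8; 4; 4; 0; 2; 2; 0; 1; 0]);
       (3, [::], [:: 8; 4; 4; 0; 2; 2; 0; 2; 2; 0; 0; 1]);
       (2, [::], [:: 0; 1; 1; 0; 1; 0; 0; 2; 2; 8; 4; 4]);
       (2, [::], [:: 0; 1; 1; 0; 0; 1; 0; 2; 2; 8; 4; 4]);
       (1, [::], [:: 0; 2; 2; 8; 4; 4; 0; 2; 2; 0; 1; 1])]))
    (Leaf 32
     [:: (3, [::], [:: 0; 0; 0; 0; 0; 0; 0; 0; 1; 4; 0; 2]);
      (4, [::], [:: 0; 0; 0; 0; 0; 0; 0; 1; 1; 4; 2; 2]);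
      (2, [::], [:: 8; 4; 0; 0; 0; 2; 0; 2; 1; 0; 1; 0]);
      (2, [::], [:: 8; 4; 4; 0; 2; 2; 0; 2; 2; 0; 0; 1]);
      (6, [::], [:: 0; 2; 0; 8; 4; 4; 0; 2; 2; 0; 1; 0]);
      (4, [::], [:: 0; 1; 1; 0; 1; 0; 0; 2; 2; 8; 4; 4])]))
   (Leaf 38
    [:: (5, [::], [:: 0; 0; 0; 0; 0; 0; 0; 1; 1; 4; 2; 2]);
     (3, [::], [:: 0; 0; 2; 8; 4; 4; 0; 2; 2; 0; 1; 0]);
     (3, [::], [:: 0; 2; 0; 8; 4; 4; 0; 2; 2; 0; 1; 0]);
     (2, [::], [:: 0; 1; 1; 0; 1; 0; 0; 2; 2; 8; 4; 4]);
     (2, [::], [:: 0; 1; 1; 0; 0; 1; 0; 2; 2; 8; 4; 4]);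
     (7, [::], [:: 8; 4; 4; 0; 2; 2; 0; 2; 2; 0; 1; 0])]))
  (Leaf 22
   [:: (1, [::], [:: 16; 8; 8; 0; 4; 0; 0; 0; 4; 0; 1; 2]);
    (2, [::], [:: 0; 1; 2; 0; 0; 2; 0; 0; 4; 16; 8; 8]);
    (1, [::], [:: 0; 2; 0; 8; 4; 4; 0; 2; 2; 0; 1; 0]);
    (3, [::], [:: 0; 2; 2; 8; 4; 4; 0; 2; 2; 0; 1; 1]);
    (1, [::], [:: 8; 4; 4; 0; 2; 2; 0; 2; 2; 0; 1; 0])])).

(** Root [v_0], vertex 9, on the triangle. The outermost splits concern the vertices 4, 2, 5 and 1,
    which are exactly those at distance 3 from the root. *)
Definition cert_v0 : cert :=
 (Split 4 1
  (Split 2 1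
   (Split 5 1
    (Split 1 1
     (Split 8 3
      (Leaf 43
       [:: (18, [::], [:: 0; 2; 4; 2; 2; 4; 0; 1; 8; 0; 0; 16]);
        (2, [::], [:: 4; 2; 0; 4; 2; 2; 8; 1; 1; 0; 0; 0]);
        (2, [::], [:: 8; 0; 4; 0; 2; 0; 16; 1; 2; 0; 0; 0]);
        (3, [::], [:: 2; 4; 2; 0; 4; 2; 0; 8; 1; 0; 16; 0]);
        (16, [::], [:: 1; 1; 2; 0; 1; 2; 0; 0; 4; 0; 0; 8])])
      (Split 7 3
       (Leaf 15
        [:: (1, [::], [:: 0; 2; 4; 2; 2; 4; 0; 1; 8; 0; 0; 16]);
         (6, [::], [:: 0; 2; 1; 1; 2; 1; 0; 4; 0; 0; 8; 0]);
         (2, [::], [:: 4; 2; 2; 4; 2; 0; 8; 1; 1; 0; 0; 0]);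
         (4, [::], [:: 2; 4; 2; 0; 4; 2; 0; 8; 1; 0; 16; 0]);
         (2, [::], [:: 0; 4; 0; 0; 4; 2; 0; 8; 1; 0; 16; 0])])
       (Split 7 1
        (Split 8 1
         (Split 0 1
          (Split 3 1
           (Split 2 4
            (Leaf 0
             [:: (1, [:: (2,4); (4,3); (3,6); (2,0); (0,6)],
                  [:: 0; 0; 0; 0; 0; 0; 1; 0; 0; 0; 0; 0])])
            (Split 7 2
             (Leaf 14
              [:: (1, [::], [:: 0; 2; 4; 2; 2; 4; 0; 1; 8; 0; 0; 16]);
               (6, [::], [:: 0; 2; 1; 1; 2; 1; 0; 4; 0; 0; 8; 0]);
               (3, [:: (7,4); (4,3); (3,6)], [:: 8; 0; 4; 0; 0; 1; 16; 0; 2; 0; 0; 0]);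
               (2, [:: (7,1); (1,0); (0,6)], [:: 0; 0; 1; 4; 2; 2; 8; 0; 1; 0; 0; 0])])
             (Split 10 1
              (Leaf 9
               [:: (1, [::], [:: 2; 2; 4; 2; 1; 4; 0; 1; 8; 0; 8; 16]);
                (5, [::], [:: 1; 0; 0; 0; 0; 0; 2; 0; 0; 0; 0; 0]);
                (8, [::], [:: 0; 2; 1; 1; 2; 1; 0; 4; 0; 0; 8; 0]);
                (5, [::], [:: 2; 4; 2; 0; 4; 2; 0; 8; 1; 0; 16; 0])])
              (Split 11 1
               (Leaf 1
                [:: (1, [::], [:: 1; 0; 0; 0; 0; 0; 2; 0; 0; 0; 0; 0]);
                 (1, [::], [:: 0; 2; 4; 2; 2; 4; 0; 1; 8; 0; 0; 16]);
                 (1, [::], [:: 2; 0; 4; 0; 2; 4; 0; 1; 8; 0; 0; 16])])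
               (Split 4 4
                (Leaf 0
                 [:: (1, [:: (4,2); (4,3); (3,6); (2,0); (0,6)],
                      [:: 0; 0; 0; 0; 0; 0; 1; 0; 0; 0; 0; 0])])
                (Split 8 2
                (Leaf 1
                 [:: (1, [:: (8,5); (5,3); (3,6)], [:: 4; 2; 2; 0; 1; 0; 8; 0; 0; 0; 0; 0]);
                  (1, [:: (8,2); (2,0); (0,6)], [:: 0; 1; 0; 4; 2; 2; 8; 0; 0; 0; 0; 0])])
                (Split 2 2
                (Leaf 1
                 [:: (1, [:: (2,0); (0,6)], [:: 0; 0; 0; 2; 0; 1; 4; 0; 0; 0; 0; 0]);
                  (1, [:: (2,0); (0,6)], [:: 0; 0; 0; 2; 1; 0; 4; 0; 0; 0; 0; 0]);
                  (1, [:: (2,4); (4,3); (3,6)], [:: 2; 1; 0; 0; 0; 0; 4; 0; 0; 0; 0; 0])])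
                (Split 5 4
                (Leaf 0
                 [:: (1, [:: (5,1); (5,3); (3,6); (1,0); (0,6)],
                      [:: 0; 0; 0; 0; 0; 0; 1; 0; 0; 0; 0; 0])])
                (Split 4 2
                (Leaf 1
                 [:: (1, [:: (4,2); (2,0); (0,6)], [:: 0; 0; 0; 2; 0; 1; 4; 0; 0; 0; 0; 0]);
                  (1, [:: (4,3); (3,6)], [:: 2; 1; 0; 0; 0; 0; 4; 0; 0; 0; 0; 0])])
                (Split 1 2
                (Leaf 1
                 [:: (1, [:: (1,5); (5,3); (3,6)], [:: 2; 1; 0; 0; 0; 0; 4; 0; 0; 0; 0; 0]);
                  (1, [:: (1,0); (0,6)], [:: 0; 0; 0; 2; 0; 1; 4; 0; 0; 0; 0; 0])])
                (Leaf 3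
                 [:: (1, [::], [:: 4; 2; 2; 4; 2; 2; 8; 1; 1; 0; 0; 0])])))))))))))
           (Split 6 1
            (Leaf 7
             [:: (2, [::], [:: 0; 1; 0; 0; 1; 0; 0; 2; 0; 0; 4; 0]);
              (6, [::], [:: 4; 2; 0; 0; 0; 1; 8; 0; 0; 0; 0; 0]);
              (4, [::], [:: 8; 0; 4; 0; 2; 0; 16; 1; 2; 0; 0; 0]);
              (1, [::], [:: 2; 0; 4; 0; 2; 4; 0; 1; 8; 0; 0; 16])])
            (Split 0 2
             (Leaf 16
              [:: (1, [::], [:: 2; 4; 2; 0; 4; 2; 0; 8; 1; 0; 16; 0]);
               (1, [::], [:: 4; 2; 2; 0; 0; 1; 8; 1; 1; 0; 0; 0]);
               (3, [::], [:: 4; 2; 2; 0; 1; 1; 8; 0; 1; 0; 0; 0]);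
               (3, [::], [:: 4; 2; 2; 0; 1; 0; 8; 1; 1; 0; 0; 0]);
               (3, [:: (0,6)], [:: 0; 1; 0; 4; 2; 2; 8; 1; 0; 0; 0; 0]);
               (1, [:: (0,2); (2,8)], [:: 0; 2; 0; 0; 0; 4; 0; 1; 8; 0; 0; 16])])
             (Split 1 4
              (Leaf 4
               [:: (1, [::], [:: 2; 4; 2; 0; 4; 2; 0; 8; 1; 0; 16; 0]);
                (1, [::], [:: 4; 2; 2; 0; 1; 0; 8; 0; 1; 0; 0; 0]);
                (2, [:: (1,7); (7,4); (4,3); (1,0); (0,6)],
                 [:: 0; 0; 0; 2; 0; 1; 4; 0; 0; 0; 0; 0]);
                (1, [:: (1,5); (1,0); (0,2); (2,8)], [:: 0; 0; 0; 0; 0; 1; 0; 0; 2; 0; 0; 4])])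
              (Split 4 2
               (Split 4 3
                (Split 2 2
                (Leaf 7
                 [:: (1, [::], [:: 2; 0; 4; 0; 2; 4; 0; 1; 8; 0; 0; 16]);
                  (1, [:: (4,7); (7,1); (1,0)], [:: 8; 0; 4; 0; 0; 1; 16; 0; 2; 0; 0; 0]);
                  (4, [:: (4,3); (2,0); (0,6)], [:: 0; 1; 0; 4; 0; 2; 8; 0; 0; 0; 0; 0]);
                  (2, [:: (4,7); (7,10); (2,4); (4,7)], [:: 0; 2; 0; 0; 0; 1; 0; 4; 0; 0; 8; 0]);
                  (6, [:: (2,0); (0,6)], [:: 0; 0; 0; 2; 1; 0; 4; 0; 0; 0; 0; 0])])
                (Leaf 10
                 [:: (2, [::], [:: 2; 4; 2; 0; 4; 2; 0; 8; 1; 0; 16; 0]);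
                  (2, [:: (4,2); (2,8)], [:: 0; 1; 0; 0; 0; 2; 0; 0; 4; 0; 0; 8]);
                  (1, [:: (4,7); (7,1); (1,0); (0,6)], [:: 0; 0; 1; 4; 2; 2; 8; 0; 0; 0; 0; 0])]))
                (Leaf 7
                 [:: (1, [:: (4,7)], [:: 2; 4; 1; 0; 0; 2; 0; 8; 0; 0; 16; 0]);
                  (1, [:: (4,2)], [:: 4; 2; 2; 0; 0; 1; 8; 0; 0; 0; 0; 0]);
                  (2, [:: (4,2); (2,8)], [:: 0; 1; 2; 0; 0; 2; 0; 0; 4; 0; 0; 8])]))
               (Split 7 2
                (Leaf 6
                 [:: (1, [::], [:: 2; 4; 2; 0; 4; 2; 0; 8; 1; 0; 16; 0]);
                  (1, [::], [:: 0; 2; 4; 0; 2; 4; 0; 1; 8; 0; 0; 16])])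
                (Split 10 1
                (Leaf 5
                 [:: (3, [::], [:: 2; 4; 2; 0; 4; 2; 0; 8; 1; 0; 16; 0]);
                  (1, [::], [:: 2; 0; 4; 0; 2; 4; 0; 1; 8; 0; 0; 16])])
                (Split 1 2
                (Leaf 5
                 [:: (1, [::], [:: 1; 1; 2; 0; 1; 2; 0; 0; 4; 0; 0; 8]);
                  (1, [::], [:: 4; 2; 2; 0; 0; 1; 8; 1; 1; 0; 0; 0]);
                  (1, [:: (1,0); (0,6)], [:: 0; 0; 1; 4; 2; 2; 8; 0; 0; 0; 0; 0])])
                (Leaf 2
                 [:: (1, [::], [:: 1; 1; 2; 0; 1; 2; 0; 0; 4; 0; 0; 8])])))))))))
          (Split 3 1
           (Split 6 1
            (Leaf 7
             [:: (2, [::], [:: 0; 1; 0; 0; 1; 0; 0; 2; 0; 0; 4; 0]);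
              (4, [::], [:: 0; 1; 0; 4; 2; 2; 8; 0; 1; 0; 0; 0]);
              (1, [::], [:: 0; 2; 4; 2; 2; 4; 0; 1; 8; 0; 0; 16]);
              (6, [::], [:: 0; 1; 1; 4; 2; 2; 8; 1; 0; 0; 0; 0])])
            (Split 3 2
             (Leaf 30
              [:: (3, [::], [:: 0; 2; 4; 2; 2; 4; 0; 1; 8; 0; 0; 16]);
               (12, [::], [:: 0; 1; 1; 4; 2; 2; 8; 1; 0; 0; 0; 0]);
               (3, [:: (3,6)], [:: 4; 2; 2; 0; 0; 0; 8; 0; 1; 0; 0; 0]);
               (2, [:: (3,4); (4,7)], [:: 0; 4; 0; 0; 0; 2; 0; 8; 1; 0; 16; 0])])
             (Split 5 4
              (Leaf 4
               [:: (1, [::], [:: 0; 2; 4; 2; 2; 4; 0; 1; 8; 0; 0; 16]);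
                (1, [::], [:: 0; 1; 1; 4; 2; 2; 8; 1; 0; 0; 0; 0]);
                (2, [:: (5,8); (8,2); (5,3); (3,6); (2,0)],
                 [:: 2; 1; 0; 0; 0; 0; 4; 0; 0; 0; 0; 0]);
                (1, [:: (5,1); (5,3); (3,4); (4,7)], [:: 0; 1; 0; 0; 0; 0; 0; 2; 0; 0; 4; 0])])
              (Split 1 4
               (Leaf 3
                [:: (1, [::], [:: 0; 4; 0; 0; 4; 2; 0; 8; 1; 0; 16; 0]);
                 (1, [:: (1,0); (1,0); (0,6)], [:: 0; 0; 0; 4; 0; 2; 8; 0; 1; 0; 0; 0]);
                 (1, [:: (1,5); (1,7); (7,4); (4,2); (2,8)],
                  [:: 0; 0; 0; 0; 0; 1; 0; 0; 2; 0; 0; 4]);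
                 (3, [:: (1,5); (5,3); (3,6); (1,0)], [:: 2; 0; 1; 0; 0; 0; 4; 0; 0; 0; 0; 0])])
               (Split 2 4
                (Leaf 3
                 [:: (1, [::], [:: 0; 2; 4; 2; 2; 4; 0; 1; 8; 0; 0; 16]);
                  (1, [:: (2,4); (4,3); (3,6); (2,0)], [:: 4; 2; 0; 0; 0; 0; 8; 1; 0; 0; 0; 0]);
                  (1, [:: (2,4); (4,7); (7,10); (2,8); (8,5); (5,1)],
                   [:: 0; 1; 0; 0; 0; 0; 0; 2; 0; 0; 4; 0]);
                  (2, [:: (2,0); (2,0); (0,6)], [:: 0; 0; 0; 2; 1; 0; 4; 0; 0; 0; 0; 0])])
                (Split 2 2
                (Split 4 2
                (Leaf 7
                 [:: (1, [::], [:: 0; 2; 4; 2; 2; 4; 0; 1; 8; 0; 0; 16]);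
                  (2, [:: (4,3); (3,6); (2,0)], [:: 4; 2; 0; 0; 0; 1; 8; 0; 0; 0; 0; 0]);
                  (2, [:: (4,3); (3,6)], [:: 4; 2; 2; 0; 0; 1; 8; 0; 0; 0; 0; 0]);
                  (2, [:: (2,8); (8,5); (5,3)], [:: 0; 0; 0; 2; 1; 0; 4; 0; 0; 0; 0; 0]);
                  (3, [:: (2,8); (8,5); (5,1); (1,7)], [:: 0; 0; 0; 0; 1; 0; 0; 2; 0; 0; 4; 0])])
                (Leaf 6
                 [:: (1, [::], [:: 0; 2; 4; 2; 2; 4; 0; 1; 8; 0; 0; 16]);
                  (1, [:: (2,4); (4,3); (3,6)], [:: 4; 2; 0; 0; 0; 1; 8; 0; 0; 0; 0; 0]);
                  (1, [:: (2,4); (4,7)], [:: 0; 2; 0; 0; 0; 1; 0; 4; 0; 0; 8; 0])]))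
                (Split 8 2
                (Leaf 6
                 [:: (1, [::], [:: 0; 2; 4; 2; 2; 4; 0; 1; 8; 0; 0; 16]);
                  (1, [::], [:: 0; 4; 0; 0; 4; 2; 0; 8; 1; 0; 16; 0])])
                (Split 11 1
                (Leaf 2
                 [:: (1, [::], [:: 0; 1; 0; 0; 1; 0; 0; 2; 0; 0; 4; 0]);
                  (1, [::], [:: 0; 2; 4; 2; 2; 4; 0; 1; 8; 0; 0; 16])])
                (Split 1 2
                (Split 1 3
                (Split 4 2
                (Leaf 3
                 [:: (1, [::], [:: 0; 4; 0; 0; 4; 2; 0; 8; 1; 0; 16; 0]);
                  (2, [:: (4,2); (2,0); (1,0); (0,6)], [:: 0; 0; 0; 2; 0; 1; 4; 0; 0; 0; 0; 0])])
                (Leaf 5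
                 [:: (1, [::], [:: 0; 4; 0; 0; 4; 2; 0; 8; 1; 0; 16; 0])]))
                (Leaf 9
                 [:: (1, [::], [:: 0; 4; 0; 0; 4; 2; 0; 8; 1; 0; 16; 0]);
                  (3, [::], [:: 0; 1; 0; 4; 2; 2; 8; 1; 1; 0; 0; 0])]))
                (Leaf 7
                 [:: (1, [::], [:: 0; 4; 0; 0; 4; 2; 0; 8; 1; 0; 16; 0]);
                  (2, [::], [:: 0; 1; 0; 4; 2; 2; 8; 1; 1; 0; 0; 0])]))))))))))
           (Leaf 15
            [:: (1, [::], [:: 4; 2; 2; 0; 1; 1; 8; 0; 0; 0; 0; 0]);
             (4, [::], [:: 0; 1; 2; 0; 1; 2; 0; 0; 4; 0; 0; 8]);
             (1, [::], [:: 0; 1; 1; 4; 2; 2; 8; 1; 0; 0; 0; 0]);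
             (2, [::], [:: 0; 4; 2; 0; 4; 2; 0; 8; 1; 0; 16; 0])])))
         (Split 7 2
          (Leaf 27
           [:: (1, [::], [:: 0; 2; 1; 1; 2; 1; 0; 4; 0; 0; 8; 0]);
            (10, [::], [:: 0; 2; 1; 0; 2; 1; 0; 4; 0; 0; 8; 0]);
            (3, [::], [:: 4; 2; 2; 4; 2; 2; 8; 1; 0; 0; 0; 0]);
            (3, [:: (7,1); (1,5); (5,8)], [:: 0; 0; 1; 0; 0; 0; 0; 0; 2; 0; 0; 4]);
            (7, [:: (7,1); (1,0)], [:: 2; 0; 1; 2; 0; 1; 4; 0; 0; 0; 0; 0]);
            (1, [:: (7,4); (4,2); (2,8)], [:: 1; 2; 0; 0; 0; 4; 0; 0; 8; 0; 0; 16])])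
          (Split 2 7
           (Leaf 1
            [:: (1, [::], [:: 4; 2; 2; 0; 1; 1; 8; 0; 0; 0; 0; 0]);
             (1, [::], [:: 4; 2; 2; 0; 0; 1; 8; 1; 0; 0; 0; 0]);
             (1, [::], [:: 0; 1; 2; 0; 0; 2; 0; 0; 4; 0; 0; 8]);
             (1, [:: (2,4); (4,3); (2,0); (2,0); (0,6)], [:: 0; 0; 0; 1; 0; 0; 2; 0; 0; 0; 0; 0]);
             (1, [:: (2,4); (4,7); (7,10)], [:: 0; 0; 0; 0; 0; 0; 0; 0; 0; 0; 1; 0])])
           (Split 0 1
            (Split 11 1
             (Split 3 1
              (Split 1 4
               (Leaf 0
                [:: (1, [:: (1,5); (5,3); (3,6); (1,0); (0,6)],
                     [:: 0; 0; 0; 0; 0; 0; 1; 0; 0; 0; 0; 0])])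
               (Split 4 2
                (Leaf 4
                 [:: (1, [::], [:: 0; 2; 1; 1; 2; 1; 0; 4; 0; 0; 8; 0]);
                  (2, [:: (4,2); (2,0); (0,6)], [:: 0; 0; 0; 2; 1; 0; 4; 0; 0; 0; 0; 0]);
                  (2, [:: (4,3); (3,6)], [:: 4; 0; 2; 0; 1; 0; 8; 0; 0; 0; 0; 0]);
                  (2, [:: (4,3); (3,6)], [:: 2; 1; 0; 0; 0; 0; 4; 0; 0; 0; 0; 0]);
                  (2, [:: (4,2); (2,8)], [:: 0; 1; 0; 0; 0; 2; 0; 0; 4; 0; 0; 8])])
                (Leaf 23
                 [:: (1, [::], [:: 0; 2; 4; 2; 2; 4; 0; 1; 8; 0; 0; 16]);
                  (3, [::], [:: 0; 2; 1; 1; 2; 1; 0; 4; 0; 0; 8; 0]);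
                  (4, [::], [:: 1; 1; 2; 0; 1; 2; 0; 0; 4; 0; 0; 8]);
                  (5, [::], [:: 4; 2; 2; 4; 2; 2; 8; 1; 0; 0; 0; 0])])))
              (Leaf 6
               [:: (2, [::], [:: 0; 1; 0; 0; 1; 0; 0; 2; 0; 0; 4; 0]);
                (3, [::], [:: 1; 1; 2; 0; 1; 2; 0; 0; 4; 0; 0; 8]);
                (1, [::], [:: 4; 2; 2; 0; 1; 0; 8; 1; 0; 0; 0; 0])]))
             (Split 10 1
              (Leaf 1
               [:: (1, [::], [:: 1; 0; 0; 0; 0; 0; 2; 0; 0; 0; 0; 0]);
                (1, [::], [:: 0; 2; 1; 1; 2; 1; 0; 4; 0; 0; 8; 0]);
                (1, [::], [:: 2; 4; 2; 0; 4; 2; 0; 8; 1; 0; 16; 0])])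
              (Split 5 2
               (Leaf 15
                [:: (2, [::], [:: 0; 2; 1; 0; 2; 1; 0; 4; 0; 0; 8; 0]);
                 (5, [::], [:: 4; 2; 2; 0; 1; 1; 8; 1; 0; 0; 0; 0]);
                 (3, [:: (5,1); (1,0); (0,6)], [:: 0; 0; 1; 4; 2; 2; 8; 0; 0; 0; 0; 0]);
                 (1, [:: (5,1); (1,0); (0,6)], [:: 0; 1; 0; 4; 0; 2; 8; 0; 0; 0; 0; 0])])
               (Leaf 12
                [:: (2, [::], [:: 0; 2; 1; 0; 2; 1; 0; 4; 0; 0; 8; 0]);
                 (1, [::], [:: 4; 0; 2; 4; 2; 2; 8; 1; 0; 0; 0; 0]);
                 (2, [::], [:: 4; 2; 2; 4; 2; 2; 8; 1; 0; 0; 0; 0]);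
                 (2, [::], [:: 4; 2; 2; 0; 1; 1; 8; 1; 0; 0; 0; 0])]))))
            (Split 3 1
             (Split 2 2
              (Split 11 1
               (Leaf 6
                [:: (2, [::], [:: 0; 2; 4; 2; 2; 4; 0; 1; 8; 0; 0; 16]);
                 (1, [::], [:: 0; 2; 1; 1; 2; 1; 0; 4; 0; 0; 8; 0]);
                 (1, [::], [:: 0; 1; 1; 4; 2; 2; 8; 1; 0; 0; 0; 0])])
               (Leaf 24
                [:: (3, [::], [:: 0; 2; 1; 1; 2; 1; 0; 4; 0; 0; 8; 0]);
                 (7, [::], [:: 0; 1; 1; 4; 2; 2; 8; 1; 0; 0; 0; 0]);
                 (7, [:: (2,4); (4,3); (3,6)], [:: 4; 2; 2; 0; 1; 1; 8; 0; 0; 0; 0; 0])]))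
              (Leaf 15
               [:: (1, [::], [:: 0; 2; 4; 2; 2; 4; 0; 1; 8; 0; 0; 16]);
                (5, [::], [:: 0; 2; 1; 1; 2; 1; 0; 4; 0; 0; 8; 0]);
                (3, [::], [:: 0; 1; 1; 4; 2; 2; 8; 1; 0; 0; 0; 0])]))
             (Leaf 15
              [:: (1, [::], [:: 4; 2; 2; 0; 1; 1; 8; 0; 0; 0; 0; 0]);
               (4, [::], [:: 0; 1; 2; 0; 1; 2; 0; 0; 4; 0; 0; 8]);
               (1, [::], [:: 0; 1; 1; 4; 2; 2; 8; 1; 0; 0; 0; 0]);
               (4, [::], [:: 0; 2; 1; 0; 2; 1; 0; 4; 0; 0; 8; 0])]))))))
        (Split 8 1
         (Split 8 2
          (Leaf 30
           [:: (2, [::], [:: 1; 1; 2; 0; 1; 2; 0; 0; 4; 0; 0; 8]);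
            (10, [::], [:: 0; 1; 2; 0; 1; 2; 0; 0; 4; 0; 0; 8]);
            (1, [::], [:: 4; 2; 0; 4; 2; 2; 8; 0; 1; 0; 0; 0]);
            (2, [::], [:: 4; 2; 2; 4; 2; 2; 8; 0; 1; 0; 0; 0]);
            (4, [:: (8,2); (2,4); (4,7)], [:: 0; 1; 0; 0; 0; 0; 0; 2; 0; 0; 4; 0]);
            (8, [:: (8,5); (5,3)], [:: 2; 1; 0; 2; 1; 0; 4; 0; 0; 0; 0; 0]);
            (2, [:: (8,5); (5,1); (1,7)], [:: 0; 0; 1; 1; 2; 0; 0; 4; 0; 0; 8; 0])])
          (Split 0 1
           (Split 11 1
            (Leaf 6
             [:: (1, [::], [:: 2; 2; 4; 2; 1; 4; 0; 1; 8; 0; 8; 16]);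
              (2, [::], [:: 0; 0; 0; 2; 1; 0; 4; 0; 0; 0; 0; 0]);
              (1, [::], [:: 0; 2; 4; 2; 2; 4; 0; 1; 8; 0; 0; 16]);
              (4, [::], [:: 1; 1; 2; 0; 1; 2; 0; 0; 4; 0; 0; 8])])
            (Split 10 1
             (Split 2 4
              (Leaf 0
               [:: (1, [:: (2,4); (4,7); (2,0); (0,1); (1,7); (7,10)],
                    [:: 0; 0; 0; 0; 0; 0; 0; 0; 0; 0; 1; 0])])
              (Split 3 1
               (Split 5 2
                (Leaf 1
                 [:: (1, [:: (5,1); (1,0); (0,6)], [:: 0; 0; 0; 2; 0; 1; 4; 0; 0; 0; 0; 0]);
                  (1, [:: (5,3); (3,6)], [:: 4; 2; 0; 0; 0; 1; 8; 0; 0; 0; 0; 0]);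
                  (1, [:: (5,3); (3,6)], [:: 2; 0; 1; 0; 0; 0; 4; 0; 0; 0; 0; 0]);
                  (1, [:: (5,1); (1,7)], [:: 0; 0; 1; 0; 2; 0; 0; 4; 0; 0; 8; 0])])
                (Leaf 4
                 [:: (1, [::], [:: 0; 2; 1; 1; 2; 1; 0; 4; 0; 0; 8; 0]);
                  (1, [::], [:: 4; 2; 2; 4; 2; 2; 8; 0; 1; 0; 0; 0])]))
               (Leaf 5
                [:: (2, [::], [:: 2; 4; 2; 0; 4; 2; 0; 8; 1; 0; 16; 0]);
                 (1, [::], [:: 4; 2; 2; 0; 1; 1; 8; 0; 1; 0; 0; 0])])))
             (Split 4 2
              (Leaf 15
               [:: (2, [::], [:: 1; 1; 2; 0; 1; 2; 0; 0; 4; 0; 0; 8]);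
                (5, [::], [:: 4; 2; 2; 0; 1; 1; 8; 0; 1; 0; 0; 0]);
                (3, [:: (4,2); (2,0); (0,6)], [:: 0; 1; 0; 4; 2; 2; 8; 0; 0; 0; 0; 0]);
                (1, [:: (4,2); (2,0); (0,6)], [:: 0; 0; 1; 4; 2; 0; 8; 0; 0; 0; 0; 0])])
              (Leaf 12
               [:: (2, [::], [:: 1; 1; 2; 0; 1; 2; 0; 0; 4; 0; 0; 8]);
                (2, [::], [:: 4; 2; 2; 0; 1; 1; 8; 0; 1; 0; 0; 0]);
                (1, [::], [:: 4; 2; 0; 4; 2; 2; 8; 0; 1; 0; 0; 0]);
                (2, [::], [:: 4; 2; 2; 4; 2; 2; 8; 0; 1; 0; 0; 0])]))))
           (Split 3 1
            (Split 1 6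
             (Leaf 0
              [:: (1, [:: (1,5); (5,3); (3,6); (1,0); (1,0); (0,6)],
                   [:: 0; 0; 0; 0; 0; 0; 1; 0; 0; 0; 0; 0])])
             (Split 10 1
              (Leaf 8
               [:: (4, [::], [:: 0; 2; 1; 1; 2; 1; 0; 4; 0; 0; 8; 0]);
                (2, [::], [:: 2; 1; 1; 2; 1; 1; 4; 0; 0; 0; 0; 0]);
                (1, [::], [:: 0; 1; 2; 0; 0; 2; 0; 0; 4; 0; 0; 8])])
              (Split 11 1
               (Leaf 2
                [:: (1, [::], [:: 0; 0; 0; 2; 1; 0; 4; 0; 0; 0; 0; 0]);
                 (1, [::], [:: 0; 2; 4; 2; 2; 4; 0; 1; 8; 0; 0; 16]);
                 (1, [::], [:: 0; 1; 2; 0; 0; 2; 0; 0; 4; 0; 0; 8]);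
                 (1, [::], [:: 0; 1; 2; 0; 1; 2; 0; 0; 4; 0; 0; 8])])
               (Split 1 2
                (Leaf 15
                 [:: (2, [::], [:: 0; 1; 2; 0; 1; 2; 0; 0; 4; 0; 0; 8]);
                  (3, [:: (1,5); (5,3); (3,6)], [:: 4; 2; 2; 0; 1; 0; 8; 0; 0; 0; 0; 0]);
                  (5, [::], [:: 0; 1; 1; 4; 2; 2; 8; 0; 0; 0; 0; 0]);
                  (1, [:: (1,5); (5,3); (3,6)], [:: 4; 2; 0; 0; 0; 1; 8; 0; 0; 0; 0; 0])])
                (Leaf 3
                 [:: (1, [::], [:: 0; 1; 2; 0; 1; 2; 0; 0; 4; 0; 0; 8]);
                  (1, [::], [:: 0; 1; 1; 4; 2; 2; 8; 1; 0; 0; 0; 0])])))))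
            (Leaf 96
             [:: (6, [::], [:: 4; 2; 2; 0; 1; 1; 8; 0; 0; 0; 0; 0]);
              (26, [::], [:: 0; 1; 2; 0; 1; 2; 0; 0; 4; 0; 0; 8]);
              (6, [::], [:: 0; 1; 1; 4; 2; 2; 8; 1; 0; 0; 0; 0]);
              (13, [::], [:: 0; 4; 2; 0; 4; 2; 0; 8; 1; 0; 16; 0])]))))
         (Split 1 2
          (Split 1 3
           (Split 5 2
            (Leaf 8
             [:: (1, [::], [:: 4; 2; 2; 0; 1; 1; 8; 0; 0; 0; 0; 0]);
              (2, [::], [:: 2; 1; 1; 2; 1; 1; 4; 0; 0; 0; 0; 0]);
              (1, [::], [:: 0; 1; 2; 0; 1; 2; 0; 0; 4; 0; 0; 8]);
              (1, [::], [:: 0; 2; 1; 0; 2; 1; 0; 4; 0; 0; 8; 0]);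
              (1, [:: (5,1); (1,0); (1,0); (0,6)], [:: 0; 1; 1; 4; 2; 2; 8; 0; 0; 0; 0; 0])])
            (Leaf 32
             [:: (2, [::], [:: 4; 2; 2; 0; 1; 1; 8; 0; 0; 0; 0; 0]);
              (14, [::], [:: 2; 1; 1; 2; 1; 1; 4; 0; 0; 0; 0; 0]);
              (4, [::], [:: 0; 1; 2; 0; 1; 2; 0; 0; 4; 0; 0; 8]);
              (5, [::], [:: 0; 2; 1; 0; 2; 1; 0; 4; 0; 0; 8; 0]);
              (1, [:: (1,5); (5,3)], [:: 0; 0; 1; 4; 2; 0; 8; 0; 0; 0; 0; 0])]))
           (Leaf 7
            [:: (1, [::], [:: 0; 1; 2; 0; 1; 2; 0; 0; 4; 0; 0; 8]);
             (1, [::], [:: 0; 2; 1; 0; 2; 1; 0; 4; 0; 0; 8; 0]);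
             (4, [:: (1,0)], [:: 2; 0; 1; 2; 1; 1; 4; 0; 0; 0; 0; 0])]))
          (Split 2 2
           (Split 2 3
            (Split 2 4
             (Leaf 16
              [:: (1, [::], [:: 4; 2; 2; 0; 1; 1; 8; 0; 0; 0; 0; 0]);
               (7, [::], [:: 2; 1; 1; 2; 1; 1; 4; 0; 0; 0; 0; 0]);
               (3, [::], [:: 0; 1; 2; 0; 1; 2; 0; 0; 4; 0; 0; 8]);
               (2, [::], [:: 0; 2; 1; 0; 2; 1; 0; 4; 0; 0; 8; 0]);
               (1, [:: (2,0); (2,0); (0,6)], [:: 0; 0; 0; 2; 1; 0; 4; 0; 0; 0; 0; 0])])
             (Leaf 16
              [:: (8, [::], [:: 2; 1; 1; 2; 1; 1; 4; 0; 0; 0; 0; 0]);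
               (2, [::], [:: 0; 1; 2; 0; 1; 2; 0; 0; 4; 0; 0; 8]);
               (1, [::], [:: 0; 1; 1; 4; 2; 2; 8; 1; 0; 0; 0; 0]);
               (2, [::], [:: 0; 2; 1; 0; 2; 1; 0; 4; 0; 0; 8; 0])]))
            (Leaf 16
             [:: (8, [::], [:: 2; 1; 1; 2; 1; 1; 4; 0; 0; 0; 0; 0]);
              (2, [::], [:: 0; 1; 2; 0; 1; 2; 0; 0; 4; 0; 0; 8]);
              (1, [::], [:: 0; 1; 1; 4; 2; 2; 8; 1; 0; 0; 0; 0]);
              (2, [::], [:: 0; 2; 1; 0; 2; 1; 0; 4; 0; 0; 8; 0])]))
           (Leaf 16
            [:: (8, [::], [:: 2; 0; 1; 2; 1; 1; 4; 0; 0; 0; 0; 0]);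
             (2, [::], [:: 0; 1; 2; 0; 1; 2; 0; 0; 4; 0; 0; 8]);
             (1, [::], [:: 0; 1; 1; 4; 2; 2; 8; 1; 0; 0; 0; 0]);
             (2, [::], [:: 0; 2; 1; 0; 2; 1; 0; 4; 0; 0; 8; 0])])))))))
     (Split 3 1
      (Leaf 50
       [:: (5, [::], [:: 2; 0; 4; 0; 2; 4; 0; 1; 8; 0; 0; 16]);
        (10, [::], [:: 4; 0; 2; 4; 2; 2; 8; 1; 1; 0; 0; 0]);
        (4, [::], [:: 0; 0; 2; 2; 4; 1; 0; 8; 0; 0; 16; 0]);
        (3, [::], [:: 0; 0; 1; 4; 2; 2; 8; 1; 0; 0; 0; 0])])
      (Split 0 1
       (Split 8 1
        (Split 5 2
         (Leaf 6
          [:: (1, [::], [:: 2; 0; 4; 0; 2; 4; 0; 1; 8; 0; 0; 16]);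
           (1, [::], [:: 4; 0; 2; 4; 2; 2; 8; 1; 0; 0; 0; 0]);
           (2, [:: (5,8); (8,2); (2,4); (4,7)], [:: 0; 0; 0; 0; 1; 0; 0; 2; 0; 0; 4; 0])])
         (Leaf 25
          [:: (4, [::], [:: 2; 0; 1; 2; 1; 1; 4; 0; 0; 0; 0; 0]);
           (3, [::], [:: 2; 0; 4; 0; 2; 4; 0; 1; 8; 0; 0; 16]);
           (3, [::], [:: 4; 0; 2; 4; 2; 2; 8; 1; 1; 0; 0; 0]);
           (5, [::], [:: 0; 0; 1; 0; 2; 0; 0; 4; 0; 0; 8; 0])]))
        (Leaf 25
         [:: (2, [::], [:: 2; 0; 4; 0; 2; 4; 0; 1; 8; 0; 0; 16]);
          (4, [::], [:: 0; 2; 1; 0; 2; 1; 0; 4; 0; 0; 8; 0]);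
          (7, [::], [:: 4; 0; 2; 4; 2; 2; 8; 1; 0; 0; 0; 0])]))
       (Leaf 22
        [:: (1, [::], [:: 2; 0; 4; 0; 2; 4; 0; 1; 8; 0; 0; 16]);
         (5, [::], [:: 0; 1; 2; 0; 1; 2; 0; 0; 4; 0; 0; 8]);
         (1, [::], [:: 0; 0; 1; 0; 2; 0; 0; 4; 0; 0; 8; 0]);
         (2, [::], [:: 0; 0; 2; 2; 4; 1; 0; 8; 0; 0; 16; 0]);
         (3, [::], [:: 0; 0; 1; 4; 2; 2; 8; 1; 0; 0; 0; 0])]))))
    (Split 1 1
     (Split 1 5
      (Leaf 80
       [:: (16, [::], [:: 4; 2; 2; 4; 2; 0; 8; 1; 1; 0; 0; 0]);
        (1, [::], [:: 0; 1; 2; 0; 0; 2; 0; 0; 4; 0; 0; 8]);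
        (12, [::], [:: 0; 1; 2; 0; 1; 2; 0; 0; 4; 0; 0; 8]);
        (4, [::], [:: 4; 2; 2; 0; 1; 0; 8; 0; 1; 0; 0; 0]);
        (8, [::], [:: 0; 4; 2; 2; 4; 0; 0; 8; 1; 0; 16; 0])])
      (Split 0 1
       (Leaf 84
        [:: (19, [::], [:: 4; 2; 2; 4; 2; 0; 8; 1; 1; 0; 0; 0]);
         (1, [::], [:: 4; 2; 2; 0; 0; 0; 8; 1; 1; 0; 0; 0]);
         (4, [::], [:: 2; 4; 2; 0; 4; 0; 0; 8; 1; 0; 16; 0]);
         (4, [::], [:: 0; 4; 2; 2; 4; 0; 0; 8; 1; 0; 16; 0]);
         (7, [::], [:: 2; 1; 4; 0; 2; 0; 0; 0; 8; 0; 0; 16])])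
       (Split 1 2
        (Leaf 82
         [:: (17, [::], [:: 4; 2; 2; 4; 2; 0; 8; 1; 1; 0; 0; 0]);
          (2, [::], [:: 0; 2; 1; 0; 2; 0; 0; 4; 0; 0; 8; 0]);
          (12, [::], [:: 0; 1; 2; 0; 1; 2; 0; 0; 4; 0; 0; 8]);
          (2, [::], [:: 4; 2; 2; 0; 1; 0; 8; 0; 1; 0; 0; 0]);
          (7, [::], [:: 0; 4; 2; 2; 4; 0; 0; 8; 1; 0; 16; 0]);
          (1, [:: (1,7)], [:: 0; 0; 4; 0; 2; 0; 0; 1; 8; 0; 0; 16])])
        (Leaf 86
         [:: (19, [::], [:: 4; 2; 2; 4; 2; 0; 8; 1; 1; 0; 0; 0]);
          (7, [::], [:: 0; 2; 1; 0; 2; 0; 0; 4; 0; 0; 8; 0]);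
          (5, [::], [:: 0; 4; 2; 2; 4; 0; 0; 8; 1; 0; 16; 0]);
          (8, [::], [:: 2; 1; 4; 0; 2; 0; 0; 0; 8; 0; 0; 16])]))))
     (Leaf 10
      [:: (2, [::], [:: 4; 2; 2; 4; 2; 0; 8; 1; 1; 0; 0; 0]);
       (1, [::], [:: 0; 4; 2; 2; 4; 0; 0; 8; 1; 0; 16; 0]);
       (1, [::], [:: 2; 1; 4; 0; 2; 0; 0; 0; 8; 0; 0; 16])])))
   (Split 1 1
    (Split 4 2
     (Split 0 1
      (Split 3 1
       (Leaf 46
        [:: (14, [::], [:: 4; 2; 0; 4; 2; 2; 8; 1; 1; 0; 0; 0]);
         (4, [::], [:: 0; 4; 0; 0; 4; 2; 0; 8; 1; 0; 16; 0]);
         (5, [:: (4,3); (3,5)], [:: 0; 1; 0; 0; 0; 2; 0; 0; 4; 0; 0; 8]);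
         (1, [::], [:: 2; 1; 4; 0; 2; 0; 0; 0; 8; 0; 0; 16])])
       (Leaf 144
        [:: (3, [::], [:: 0; 1; 0; 4; 2; 2; 8; 0; 1; 0; 0; 0]);
         (31, [::], [:: 4; 2; 0; 4; 2; 2; 8; 1; 1; 0; 0; 0]);
         (20, [::], [:: 1; 1; 2; 0; 1; 2; 0; 0; 4; 0; 0; 8]);
         (14, [::], [:: 0; 4; 0; 0; 4; 2; 0; 8; 1; 0; 16; 0]);
         (2, [:: (4,7)], [:: 0; 2; 0; 0; 0; 4; 0; 1; 8; 0; 0; 16])]))
      (Leaf 12
       [:: (3, [::], [:: 0; 1; 0; 0; 1; 0; 0; 2; 0; 0; 4; 0]);
        (3, [::], [:: 0; 1; 0; 4; 2; 2; 8; 0; 1; 0; 0; 0]);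
        (1, [::], [:: 0; 4; 0; 0; 4; 2; 0; 8; 1; 0; 16; 0]);
        (2, [::], [:: 0; 1; 0; 0; 0; 2; 0; 0; 4; 0; 0; 8])]))
     (Leaf 43
      [:: (11, [::], [:: 4; 2; 0; 4; 2; 2; 8; 1; 1; 0; 0; 0]);
       (4, [::], [:: 0; 4; 0; 0; 4; 2; 0; 8; 1; 0; 16; 0]);
       (7, [::], [:: 0; 1; 0; 0; 0; 2; 0; 0; 4; 0; 0; 8])]))
    (Leaf 78
     [:: (2, [::], [:: 0; 1; 0; 4; 2; 2; 8; 0; 1; 0; 0; 0]);
      (1, [::], [:: 0; 2; 4; 2; 2; 4; 0; 1; 8; 0; 0; 16]);
      (17, [::], [:: 4; 2; 0; 4; 2; 2; 8; 1; 1; 0; 0; 0]);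
      (5, [::], [:: 2; 0; 4; 0; 2; 4; 0; 1; 8; 0; 0; 16]);
      (7, [::], [:: 0; 4; 0; 0; 4; 2; 0; 8; 1; 0; 16; 0]);
      (1, [::], [:: 0; 1; 0; 0; 0; 2; 0; 0; 4; 0; 0; 8])])))
  (* From here on vertex 4, that is [y_1], is empty. *)
  (Split 2 2
   (Split 2 5
    (Leaf 92
     [:: (13, [::], [:: 0; 2; 1; 1; 2; 1; 0; 4; 0; 0; 8; 0]);
      (20, [::], [:: 4; 2; 2; 4; 0; 2; 8; 1; 1; 0; 0; 0]);
      (1, [::], [:: 0; 2; 1; 0; 2; 0; 0; 4; 0; 0; 8; 0]);
      (3, [::], [:: 4; 2; 2; 0; 0; 1; 8; 1; 0; 0; 0; 0]);
      (9, [::], [:: 0; 2; 4; 0; 0; 4; 0; 1; 8; 0; 0; 16]);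
      (1, [::], [:: 0; 0; 1; 0; 2; 0; 0; 4; 0; 0; 8; 0])])
    (Split 0 1
     (Leaf 102
      [:: (24, [::], [:: 4; 2; 2; 4; 0; 2; 8; 1; 1; 0; 0; 0]);
       (1, [::], [:: 4; 2; 2; 0; 0; 1; 8; 1; 0; 0; 0; 0]);
       (9, [::], [:: 0; 2; 4; 0; 0; 4; 0; 1; 8; 0; 0; 16]);
       (5, [::], [:: 0; 2; 1; 0; 2; 1; 0; 4; 0; 0; 8; 0]);
       (6, [::], [:: 2; 4; 1; 1; 0; 2; 0; 8; 1; 0; 16; 0])])
     (Leaf 155
      [:: (1, [::], [:: 2; 1; 1; 2; 0; 0; 4; 0; 0; 0; 0; 0]);
       (22, [::], [:: 0; 2; 1; 1; 2; 1; 0; 4; 0; 0; 8; 0]);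
       (33, [::], [:: 4; 2; 2; 4; 0; 2; 8; 1; 1; 0; 0; 0]);
       (3, [::], [:: 4; 2; 2; 0; 0; 1; 8; 1; 0; 0; 0; 0]);
       (15, [::], [:: 0; 2; 4; 0; 0; 4; 0; 1; 8; 0; 0; 16]);
       (2, [:: (2,8)], [:: 0; 4; 0; 0; 0; 2; 0; 8; 1; 0; 16; 0])])))
   (Leaf 17
    [:: (1, [::], [:: 0; 2; 0; 0; 0; 1; 0; 4; 0; 0; 8; 0]);
     (4, [::], [:: 4; 2; 2; 4; 0; 2; 8; 1; 1; 0; 0; 0]);
     (1, [::], [:: 0; 1; 2; 0; 0; 2; 0; 0; 4; 0; 0; 8]);
     (1, [::], [:: 0; 2; 4; 0; 0; 4; 0; 1; 8; 0; 0; 16]);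
     (1, [::], [:: 2; 4; 1; 1; 0; 2; 0; 8; 1; 0; 16; 0])]))).

(* The lists are automorphisms of the graph, as the images of [0, ..., 11]. *)
Definition J3_certs : seq cert :=
  let s01 := [:: 1; 0; 5; 4; 3; 2; 7; 6; 8; 10; 9; 11] in
  let s02 := [:: 2; 0; 4; 5; 3; 1; 8; 6; 7; 11; 9; 10] in
  let s03 := [:: 3; 4; 5; 0; 1; 2; 6; 7; 8; 9; 10; 11] in
  let s04 := [:: 4; 2; 3; 1; 5; 0; 7; 8; 6; 10; 11; 9] in
  let s05 := [:: 5; 1; 3; 2; 4; 0; 8; 7; 6; 11; 10; 9] in
  [:: cert_x0; relabel s01 cert_x0; relabel s02 cert_x0;
      relabel s03 cert_x0; relabel s04 cert_x0; relabel s05 cert_x0;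
      cert_z0; relabel s01 cert_z0; relabel s02 cert_z0;
      cert_v0; relabel s01 cert_v0; relabel s02 cert_v0].

(** * The pebbling number of [J_3] *)

Definition J3_rel : rel nat :=
  fun u w => ((u, w) \in J3_edges) || ((w, u) \in J3_edges).

(** The entry of index [r] in [J3_certs] serves the root [r]. The initial upper bound is the size
    12, except at the root, where it is 0 because a pebble there is already a solution. *)
Lemma J3_certs_check :
  all (fun r => check 12 J3_rel 12 r (fun=> 0) (upd (fun=> 12) r 0)
      (nth cert_x0 J3_certs r))
    (iota 0 12).
Proof. by vm_compute. Qed.

Lemma J3_all_solvable : all_solvable J3_adj 12.
Proof.
move=> r C C12; have /allP/(_ (val r)) := J3_certs_check.
rewrite mem_iota ltn_ord => /(_ isT).
(* The case of an occupied root is settled here; in the other case the upper bound 0 at [r] is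
   justified. *)
have [Cr|Cr _] := posnP (C r); last by exists C; split=> //; apply: rt_refl.
apply: check_solvable => // i; rewrite /upd; case: eqP => [/val_inj->|_].
  by rewrite Cr.
by rewrite /= (leq_trans _ (eq_leq C12)) // /config_size (bigD1 i) //= leq_addr.
Qed.

Theorem theorem1 :
  class0 J3_adj /\ is_pebbling_number J3_adj 12.
Proof.
(* As ['I_12] has 12 elements, both conjuncts are the same statement. *)
suff J3_12 : is_pebbling_number J3_adj 12 by rewrite /class0 card_ord.
split=> [|t t12]; first exact: J3_all_solvable.
by apply: not_all_solvable_lt_card; rewrite card_ord.
Qed.
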